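(* Let $J$ be an instance consisting only of $(1/2)$-tight jobs, i.e. $p_j>\frac12(d_j-r_j)$ for every $j\in J$, and let $\beta\in(0,1)$. Let $J_\beta$ be the instance obtained from $J$ by replacing each job $j$ by a job $j_\beta$ with the same time window $[r_j,d_j]$ and processing time $p_j+(1-\beta)(d_j-r_j-p_j)$ (so its laxity is $\beta(d_j-r_j-p_j)$). Then $m(J_\beta)\le \frac{4}{\beta}\, m(J)$.
   Context: Each job $j$ has release date $r_j$, processing time $p_j$ and deadline $d_j$ (here possibly rational, processing may be split at arbitrary times) with $p_j\le d_j-r_j$. For a job set $J$, $m(J)$ denotes the minimum number of identical machines admitting a feasible preemptive schedule, i.e. one processing each job for $p_j$ time units within $[r_j,d_j]$, with each machine processing at most one job at a time, no job on two machines simultaneously, and preemption and migration allowed. *)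

(* Defs.v *)
From mathcomp Require Import all_boot all_order all_algebra.
From mathcomp Require Import all_classical all_reals.

Set Implicit Arguments.
Unset Strict Implicit.
Unset Printing Implicit Defensive.

Import Order.TTheory GRing.Theory Num.Theory.
Local Open Scope ring_scope.

Record job (R : realType) := Job {
  release : R;
  ptime : R;
  deadline : R }.

Definition valid_job (R : realType) (j : job R) : bool :=
  0 <= ptime j <= deadline j - release j.

Definition tight (R : realType) (alpha : R) (j : job R) : bool :=
  alpha * (deadline j - release j) < ptime j.

(* An instance is a family of jobs indexed by a finite type, so that two
   distinct jobs may have the same parameters. A slot says that its machine
   processes its job throughout the time interval [slot_start, slot_end[. *)
Record slot (R : realType) (I : finType) (m : nat) := Slot {
  slot_job : I;
  slot_machine : 'I_m;
  slot_start : R;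
  slot_end : R }.

(* Nothing ties the slots of one job to a single machine: a finite sequence of
   slots describes a schedule with preemption and migration. *)
Definition compatible (R : realType) (I : finType) (m : nat)
    (x y : slot R I m) : bool :=
  (slot_machine x == slot_machine y) || (slot_job x == slot_job y) ==>
  (slot_end x <= slot_start y) || (slot_end y <= slot_start x).

Definition is_schedule (R : realType) (I : finType) (J : I -> job R) (m : nat)
    (S : seq (slot R I m)) : Prop :=
  [/\ all (fun x => slot_start x < slot_end x) S,
      all (fun x => (release (J (slot_job x)) <= slot_start x) &&
                    (slot_end x <= deadline (J (slot_job x)))) S,
      pairwise (@compatible R I m) S
    & forall i : I,
        \sum_(x <- S | slot_job x == i) (slot_end x - slot_start x)
        = ptime (J i)].

Definition feasible (R : realType) (I : finType) (J : I -> job R) (m : nat) :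
    Prop :=
  exists S : seq (slot R I m), is_schedule J S.

Definition is_min_machines (R : realType) (I : finType) (J : I -> job R)
    (m : nat) : Prop :=
  feasible J m /\ forall k : nat, feasible J k -> (m <= k)%N.

(* The default value 0 is only taken when no number of machines suffices, which
   by [min_machinesP] does not happen for valid jobs. *)
Definition min_machines (R : realType) (I : finType) (J : I -> job R) : nat :=
  xget 0%N [set m : nat | is_min_machines J m]%classic.

Definition reduce_laxity (R : realType) (beta : R) (j : job R) : job R :=
  Job (release j)
      (ptime j + (1 - beta) * (deadline j - release j - ptime j))
      (deadline j).

Lemma feasible_card (R : realType) (I : finType) (J : I -> job R) :
  (forall i, valid_job (J i)) -> feasible J #|I|.
Proof.
move=> vJ.
pose f i := @Slot R I #|I| i (enum_rank i) (release (J i))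
                  (release (J i) + ptime (J i)).
exists [seq f i | i <- enum I & 0 < ptime (J i)]; split.
- by rewrite all_map all_filter; apply/allP => i _ /=; rewrite ltrDl implybb.
- rewrite all_map; apply/allP => i _ /=; rewrite lexx /=.
  by rewrite -lerBrDl; case/andP: (vJ i).
- rewrite pairwise_map; apply: (@sub_pairwise _ [rel x y | x != y]).
    move=> i k /= nik; rewrite /compatible /=.
    by rewrite (inj_eq enum_rank_inj) orbb (negbTE nik).
  by rewrite -uniq_pairwise filter_uniq ?enum_uniq.
- move=> i; rewrite big_map big_filter_cond big_enum_cond /=.
  have [p0|p0] := boolP (0 < ptime (J i)).
    rewrite (eq_bigl (pred1 i)); last first.
      by move=> k /=; have [->|_] := eqVneq k i; rewrite ?p0 ?andbF.
    by rewrite big_pred1_eq /= [release _ + _]addrC addrK.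
  have -> : ptime (J i) = 0.
    by apply/le_anti; rewrite leNgt p0; case/andP: (vJ i) => ->.
  by rewrite big1 // => k /andP[pk /eqP ki]; move: pk p0; rewrite -ki /= => ->.
Qed.

Lemma min_machinesP (R : realType) (I : finType) (J : I -> job R) :
  (forall i, valid_job (J i)) -> is_min_machines J (min_machines J).
Proof.
move=> vJ; rewrite /min_machines.
have ex : exists m, `[< feasible J m >].
  by exists #|I|; apply/asboolP; exact: feasible_card.
have [m /asboolP fm mP] := ex_minnP ex.
have minm : is_min_machines J m.
  by split=> // k fk; apply: mP; apply/asboolP.
exact: (@xgetPex _ 0%N [set m | is_min_machines J m]%classic (ex_intro _ m minm)).
Qed.

(* Main.v *)
Require Import Defs.
From mathcomp Require Import all_boot all_order all_algebra.
From mathcomp Require Import all_classical all_reals.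
From mathcomp Require Import ring lra zify.

Set Implicit Arguments.
Unset Strict Implicit.
Unset Printing Implicit Defensive.

Import Order.TTheory GRing.Theory Num.Theory.
Local Open Scope ring_scope.

(** Cut the time line at the release dates and deadlines into intervals of
    lengths [e k]. Jobs with windows of length [d_j] and laxities [l_j] fit on
    [n] machines as soon as every set [B] of intervals has length at least
    [1 / n] times the load [sum_j max(0, |B inter window_j| - l_j)] that it is
    forced to receive: this is Gale's theorem for the transportation problem
    between jobs and intervals, followed by McNaughton's wrap-around rule.

    To bound this load for the laxities [beta * l_j], enlarge [B] to the set [W]
    of points that lie at one end of an interval in which [B] has density at
    least [beta]. Then [|W| <= (2 / beta - 1) |B|], and each window is either
    covered by [W] or meets it in at least [1 / beta] times what it shares with
    [B]. Since tight jobs satisfy [l_j < p_j], the load forced into [B] by the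
    new jobs is at most twice the load forced into [W] by the old ones, hence at
    most [2 (2 / beta - 1) m |B| <= (4 m / beta - 1) |B|]; the [- 1] pays for
    rounding [4 m / beta] down to an integer. *)

(* [try lra] prunes the inconsistent orderings as soon as they arise. *)
Ltac minmax_lra :=
  repeat match goal with
  | |- context [@Order.min _ _ ?a ?b] =>
      lazymatch constr:((a, b)) with
      | context [@Order.min _ _ _ _] => fail
      | context [@Order.max _ _ _ _] => fail
      | _ => case: (leP a b) => ?; try lra
      end
  | |- context [@Order.max _ _ ?a ?b] =>
      lazymatch constr:((a, b)) with
      | context [@Order.min _ _ _ _] => fail
      | context [@Order.max _ _ _ _] => fail
      | _ => case: (leP a b) => ?; try lra
      end
  end; lra.

(** * Cuts and Gale's theorem for transportation problems *)

(** In the network with supplies [p], edge capacities [c] and sink capacities [q], this is the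
    capacity of the cut with source side [A] and [B], minus the total supply. *)
Definition cut_slack (R : realType) (T K : finType) (p : T -> R) (q : K -> R)
    (c : T -> K -> R) (A : {set T}) (B : {set K}) : R :=
  \sum_k q k *+ (k \in B) - \sum_j p j *+ (j \in A)
  + \sum_j \sum_k c j k *+ ((j \in A) && (k \notin B)).

Lemma sum_mulrb_eq (V : zmodType) (T : finType) (F : T -> V) (x : T) :
  \sum_y F y *+ (y == x) = F x.
Proof.
rewrite (bigD1 x) //= eqxx big1 ?addr0 // => y /negbTE->.
by rewrite mulr0n.
Qed.

(** The [p] and [q] terms are modular. The edge from [j0] to [k0] leaves the first cut but neither
    the intersection nor the union, which gains the extra [c j0 k0]. *)
Lemma cut_slack_submod (R : realType) (T K : finType) (p : T -> R) (q : K -> R)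
    (c : T -> K -> R) (j0 : T) (k0 : K) (A A' : {set T}) (B B' : {set K}) :
  (forall j k, 0 <= c j k) ->
  j0 \in A -> k0 \notin B -> j0 \notin A' -> k0 \in B' ->
  cut_slack p q c (A :&: A') (B :&: B') + cut_slack p q c (A :|: A') (B :|: B')
    + c j0 k0 <= cut_slack p q c A B + cut_slack p q c A' B'.
Proof.
move=> c0 jA kB jA' kB'; rewrite /cut_slack.
have modular (U : finType) (f : U -> R) (X Y : {set U}) :
    \sum_u f u *+ (u \in X :&: Y) + \sum_u f u *+ (u \in X :|: Y)
    = \sum_u f u *+ (u \in X) + \sum_u f u *+ (u \in Y).
  rewrite -!big_split; apply: eq_bigr => u _ /=.
  by rewrite inE [in X in _ + X]inE; do 2 case: (u \in _); rewrite /= ?addr0 ?add0r.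
have := modular _ p A A'; have := modular _ q B B'.
set q1 := \sum_k q k *+ _; set q2 := \sum_k q k *+ _.
set q3 := \sum_k q k *+ _; set q4 := \sum_k q k *+ _ => Hq.
set p1 := \sum_k p k *+ _; set p2 := \sum_k p k *+ _.
set p3 := \sum_k p k *+ _; set p4 := \sum_k p k *+ _ => Hp.
suff : \sum_j \sum_k c j k *+ ((j \in A :&: A') && (k \notin B :&: B'))
     + \sum_j \sum_k c j k *+ ((j \in A :|: A') && (k \notin B :|: B'))
     + c j0 k0 <= \sum_j \sum_k c j k *+ ((j \in A) && (k \notin B))
     + \sum_j \sum_k c j k *+ ((j \in A') && (k \notin B')) by lra.
have -> : c j0 k0 = \sum_j \sum_k c j k *+ ((k == k0) && (j == j0)).
  rewrite -(sum_mulrb_eq (fun j => c j k0)); apply: eq_bigr => j _.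
  rewrite -(sum_mulrb_eq (fun k => c j k *+ (j == j0))).
  by apply: eq_bigr => k _; rewrite -mulrnA mulnb andbC.
rewrite -!big_split; apply: ler_sum => j _.
rewrite -!big_split; apply: ler_sum => k _ /=; rewrite -!mulrnDr.
apply: ler_wpMn2l; first exact: c0.
rewrite !inE; case: (k =P k0) => [->|_]; last first.
  by rewrite addn0; do 4 case: (_ \in _).
case: (j =P j0) => [->|_]; first by rewrite jA kB' (negbTE kB) (negbTE jA').
by rewrite addn0; do 4 case: (_ \in _).
Qed.

(* Gale's condition for a transportation problem is preserved when the flow on
   one edge is fixed to the largest lower bound that the cuts impose on it; that
   this value also respects all the upper bounds is submodularity of the cuts. *)
Lemma gale (R : realType) (T K : finType) (p : T -> R) (q : K -> R)
    (c : T -> K -> R) :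
  (forall j, 0 <= p j) -> (forall j k, 0 <= c j k) ->
  (forall A B, 0 <= cut_slack p q c A B) ->
  exists y : T -> K -> R,
    [/\ forall j k, 0 <= y j k <= c j k,
        forall j, \sum_k y j k = p j
      & forall k, \sum_j y j k <= q k].
Proof.
(* The induction runs over a list of the edges whose flow is still to be fixed. *)
have : forall j k, (j, k) \notin enum {: T * K} -> c j k = 0.
  by move=> j k; rewrite mem_enum.
elim: (enum _) p q c => [|[j0 k0] s IH] p q c supp p0 c0 cut.
  have {}supp j k : c j k = 0 by exact: supp.
  have cutE A B : cut_slack p q c A B =
      \sum_k q k *+ (k \in B) - \sum_j p j *+ (j \in A).
    rewrite /cut_slack [X in _ + X]big1 ?addr0 // => j _.
    by rewrite big1 // => k _; rewrite supp mul0rn.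
  (* Without capacities, the cut [{j}], [set0] forces [p j = 0] and the cut [set0], [{k}] forces
     [0 <= q k]. *)
  exists (fun _ _ => 0); split=> [j k|j|k]; first by rewrite lexx c0.
    apply/le_anti; rewrite big1 // p0 /=.
    have := cut [set j] finset.set0; rewrite cutE big1 => [|k _]; last by rewrite inE.
    under [X in _ - X]eq_bigr do rewrite inE.
    by rewrite sum_mulrb_eq sub0r oppr_ge0.
  have := cut finset.set0 [set k]; rewrite cutE [X in _ - X]big1 => [|j _]; last first.
    by rewrite inE.
  under eq_bigr do rewrite inE.
  rewrite sum_mulrb_eq subr0; apply: le_trans.
  by rewrite big1.
pose crossing (X : {set T} * {set K}) := (j0 \in X.1) && (k0 \notin X.2).
pose v := \big[Num.max/0]_(X | crossing X) (c j0 k0 - cut_slack p q c X.1 X.2).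
have v_ge0 : 0 <= v by rewrite /v; exact: bigmax_ge_id.
have v_lb (A : {set T}) (B : {set K}) :
    j0 \in A -> k0 \notin B -> c j0 k0 - cut_slack p q c A B <= v.
  move=> jA kB.
  apply: (le_bigmax_cond (j := (A, B)) _
    (fun X => c j0 k0 - cut_slack p q c X.1 X.2)).
  by rewrite /crossing jA.
have v_le_c : v <= c j0 k0.
  by apply: bigmax_le => // -[A B] _ /=; rewrite gerBl.
have v_ub (A : {set T}) (B : {set K}) :
    j0 \notin A -> k0 \in B -> v <= cut_slack p q c A B.
  move=> jA kB; apply: bigmax_le => // -[A' B'] /andP[/= jA' kB'].
  have := cut_slack_submod p q c0 jA' kB' jA kB.
  by have := cut (A' :&: A) (B' :&: B); have := cut (A' :|: A) (B' :|: B); lra.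
(* Taking [j0] out of [A] adds [p j0] to the slack and removes at least [c j0 k0]; the result is
   still nonnegative. *)
have v_le_p : v <= p j0.
  apply: bigmax_le => // -[A B] /andP[/= jA kB].
  have := cut (A :\ j0) B.
  suff : cut_slack p q c (A :\ j0) B + c j0 k0 <= cut_slack p q c A B + p j0 by lra.
  rewrite /cut_slack.
  have -> : \sum_j p j *+ (j \in A) = \sum_j p j *+ (j \in A :\ j0) + p j0.
    rewrite -[X in _ = _ + X](sum_mulrb_eq p j0) -big_split.
    apply: eq_bigr => j _ /=.
    by rewrite !inE; have [->|] := eqVneq j j0; rewrite ?jA ?addr0 ?add0r.
  suff : \sum_j \sum_k c j k *+ ((j \in A :\ j0) && (k \notin B)) + c j0 k0
      <= \sum_j \sum_k c j k *+ ((j \in A) && (k \notin B)) by lra.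
  rewrite -(sum_mulrb_eq (fun j => c j k0) j0) -big_split; apply: ler_sum => j _ /=.
  rewrite -(sum_mulrb_eq (fun k => c j k *+ (j == j0)) k0) -big_split.
  apply: ler_sum => k _ /=; rewrite -mulrnA mulnb -mulrnDr.
  apply: ler_wpMn2l => //; rewrite !inE.
  have [->|_] := eqVneq j j0; have [->|_] := eqVneq k k0 => //=; rewrite ?jA ?kB //=.
    by rewrite addn0.
  by rewrite addn0.
(* The residual problem: [v] units are shipped from [j0] to [k0] and this edge is then closed. *)
pose p' j := p j - v *+ (j == j0).
pose q' k := q k - v *+ (k == k0).
pose c' j k := c j k - c j k *+ ((j == j0) && (k == k0)).
have cut'E A B : cut_slack p' q' c' A B =
    cut_slack p q c A B + v *+ (j0 \in A) - v *+ (k0 \in B)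
    - c j0 k0 *+ ((j0 \in A) && (k0 \notin B)).
  rewrite /cut_slack /p' /q' /c'.
  have pointwise (U : finType) (f : U -> R) (X : {set U}) (u0 : U) :
      \sum_u (f u - v *+ (u == u0)) *+ (u \in X)
      = \sum_u f u *+ (u \in X) - v *+ (u0 \in X).
    rewrite -(sum_mulrb_eq (fun u => v *+ (u \in X)) u0) -sumrB.
    by apply: eq_bigr => u _; rewrite mulrnBl mulrnAC.
  rewrite !pointwise.
  have -> : \sum_j \sum_k (c j k - c j k *+ ((j == j0) && (k == k0)))
        *+ ((j \in A) && (k \notin B))
      = \sum_j \sum_k c j k *+ ((j \in A) && (k \notin B))
        - c j0 k0 *+ ((j0 \in A) && (k0 \notin B)).
    rewrite -(sum_mulrb_eq (fun j => c j k0 *+ ((j \in A) && (k0 \notin B))) j0).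
    rewrite -sumrB; apply: eq_bigr => j _.
    rewrite -(sum_mulrb_eq
      (fun k => c j k *+ ((j \in A) && (k \notin B)) *+ (j == j0)) k0).
    rewrite -sumrB; apply: eq_bigr => k _.
    rewrite mulrnBl -!mulrnA !mulnb; congr (_ - _ *+ nat_of_bool _).
    by do 2 case: (_ == _); rewrite ?andbT ?andbF.
  by ring.
have [||||y [y_c yp yq]] := IH p' q' c'.
- move=> j k; rewrite /c'; have [->|nj] := eqVneq j j0 => /=; last first.
    by move=> jks; rewrite subr0 supp // inE negb_or jks andbT xpair_eqE (negbTE nj).
  have [->|nk jks] := eqVneq k k0 => /=; first by rewrite subrr.
  by rewrite subr0 supp // inE negb_or jks andbT xpair_eqE (negbTE nk) andbF.
- move=> j; rewrite /p'; have [->|_] := eqVneq j j0; last by rewrite subr0.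
  by rewrite subr_ge0.
- by move=> j k; rewrite /c'; case: andP; rewrite ?subrr ?subr0.
- move=> A B; rewrite cut'E; have := cut A B; have := v_lb A B; have := v_ub A B.
  case: (j0 \in A); case: (k0 \in B) => /=; rewrite ?mulr1n ?mulr0n => h1 h2.
  + by lra.
  + by have := h2 isT isT; lra.
  + by have := h1 isT isT; lra.
  + by lra.
exists (fun j k => y j k + v *+ ((j == j0) && (k == k0))); split=> [j k|j|k].
- have /andP[] := y_c j k; rewrite /c'; case: andP => [[/eqP-> /eqP->]|_] /=.
    by rewrite subrr mulr1n => y0 y_le; apply/andP; split; lra.
  by rewrite subr0 addr0 => -> ->.
- rewrite big_split /= yp /p'.
  under [X in _ + X]eq_bigr do rewrite andbC -mulnb mulrnA mulrnAC.
  by rewrite sum_mulrb_eq subrK.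
- rewrite big_split /=.
  under [X in _ + X]eq_bigr do rewrite -mulnb mulrnA mulrnAC.
  by rewrite sum_mulrb_eq -lerBrDr yq.
Qed.

(** * Overlaps of intervals and their lengths *)

Definition clamp (R : realType) (u v x : R) : R := Num.min v (Num.max u x).

Lemma clamp_cat (R : realType) (u v w x : R) :
  u <= v -> v <= w -> clamp u v x + clamp v w x = v + clamp u w x.
Proof.
rewrite /clamp => uv vw.
have [xv|vx] := leP x v; last first.
  by rewrite (max_r (le_trans uv (ltW vx))) min_l // ltW.
rewrite (min_r vw) addrC; congr (_ + _).
by have := le_trans xv vw; minmax_lra.
Qed.

Lemma clamp_bounds (R : realType) (u v x : R) : u <= v -> u <= clamp u v x <= v.
Proof. by rewrite /clamp le_min ge_min le_max !lexx /= => ->. Qed.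

Lemma clamp_homo (R : realType) (u v : R) : {homo clamp u v : x y / x <= y}.
Proof. by move=> x y xy; rewrite /clamp; minmax_lra. Qed.

Lemma clamp_id (R : realType) (u v x : R) : u <= x <= v -> clamp u v x = x.
Proof. by move=> /andP[ux xv]; rewrite /clamp max_r // min_r. Qed.

Lemma clamp_ge (R : realType) (u v x : R) : v <= x -> clamp u v x = v.
Proof. by move=> vx; rewrite /clamp min_l // le_max vx orbT. Qed.

Lemma clamp_le (R : realType) (u v x : R) : u <= v -> x <= u -> clamp u v x = u.
Proof. by move=> uv xu; rewrite /clamp max_l // min_r. Qed.

Lemma clamp_point (R : realType) (u x : R) : clamp u u x = u.
Proof. by rewrite /clamp min_l // le_max lexx. Qed.

(** For [c <= d] and [u <= v], the length of [[c, d]] within [[u, v]]; as a difference of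
    projections it needs no case for disjoint intervals. *)
Definition overlap (R : realType) (c d u v : R) : R := clamp u v d - clamp u v c.

Lemma overlap_cat (R : realType) (c d u v w : R) :
  u <= v -> v <= w -> overlap c d u v + overlap c d v w = overlap c d u w.
Proof.
move=> uv vw; rewrite /overlap.
by have := clamp_cat c uv vw; have := clamp_cat d uv vw; lra.
Qed.

Lemma overlap_ge0 (R : realType) (c d u v : R) : c <= d -> 0 <= overlap c d u v.
Proof. by move=> cd; rewrite subr_ge0; exact: clamp_homo. Qed.

(** The first interval cuts a piece [[c, d]] out of [[u, v]]. The others do not overlap it, so
    induction applies to the two remainders [[u, c]] and [[d, v]]. *)
Lemma sum_overlap_le (R : realType) (X : Type) (lo hi : X -> R) (s : seq X)
    (u v : R) :
  all (fun x => lo x < hi x) s ->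
  pairwise (fun x y => (hi x <= lo y) || (hi y <= lo x)) s -> u <= v ->
  \sum_(x <- s) overlap (lo x) (hi x) u v <= v - u.
Proof.
elim: s u v => [|x s IH] u v /=; first by rewrite big_nil subr_ge0.
move=> /andP[lhx lhs] /andP[xs ps] uv; rewrite big_cons.
set c := clamp u v (lo x); set d := clamp u v (hi x).
have /andP[uc cv] : u <= c <= v by exact: clamp_bounds.
have /andP[ud dv] : u <= d <= v by exact: clamp_bounds.
have cd : c <= d by apply: clamp_homo; exact: ltW.
have -> : overlap (lo x) (hi x) u v = d - c by [].
have inside : c = d \/ lo x <= c /\ d <= hi x.
  have [hu|uh] := leP (hi x) u.
    by left; rewrite /c /d !clamp_le // (le_trans (ltW lhx)).
  have [vl|lv] := leP v (lo x).
    by left; rewrite /c /d !clamp_ge // (le_trans vl (ltW lhx)).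
  by right; rewrite /c /d /clamp; split; minmax_lra.
suff -> : \sum_(y <- s) overlap (lo y) (hi y) u v =
    \sum_(y <- s) overlap (lo y) (hi y) u c +
    \sum_(y <- s) overlap (lo y) (hi y) d v.
  by have := IH u c lhs ps uc; have := IH d v lhs ps dv; lra.
rewrite -big_split /=.
elim: s lhs xs {IH ps} => [|y s IH]; rewrite ?big_nil // !big_cons /=.
move=> /andP[lhy lhs] /andP[xy xs]; rewrite (IH lhs xs); congr (_ + _).
rewrite -(overlap_cat _ _ uc cv) -(overlap_cat _ _ cd dv).
suff -> : overlap (lo y) (hi y) c d = 0 by rewrite add0r.
apply/eqP; rewrite subr_eq0; apply/eqP.
case: inside => [<-|[lc dh]]; first by apply/le_anti; rewrite /clamp; minmax_lra.
case/orP: xy => xy; last by rewrite !clamp_le //; lra.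
by rewrite !clamp_ge //; lra.
Qed.

(** Summand [i] is the part of [[0, X]] on the [i]-th piece of length [e], an increment of
    [min X (i e)]; the sum telescopes. *)
Lemma wrap_sum (R : realType) (n : nat) (e X : R) : 0 <= e -> 0 <= X <= n%:R * e ->
  \sum_(i < n) clamp 0 e (X - i%:R * e) = X.
Proof.
move=> e0 /andP[X0 Xn].
have step i : clamp 0 e (X - i%:R * e) =
    Num.min X (i.+1%:R * e) - Num.min X (i%:R * e).
  rewrite -natr1 mulrDl mul1r /clamp; minmax_lra.
under eq_bigr do rewrite step.
rewrite -(big_mkord xpredT (fun i => Num.min X (i.+1%:R * e) - Num.min X (i%:R * e))).
rewrite (telescope_sumr (fun i => Num.min X (i%:R * e))) //.
by rewrite mul0r min_l // min_r // subr0.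
Qed.

Lemma pairwise_filter (T : Type) (r : rel T) (p : pred T) (s : seq T) :
  pairwise r s -> pairwise r [seq x <- s | p x].
Proof.
elim: s => //= x s IH /andP[xs /IH ps]; case: (p x) => //=; rewrite ps andbT.
by rewrite all_filter; apply: sub_all xs => y /= ->; rewrite implybT.
Qed.

(** * Enlarging a set of grid intervals *)

Fixpoint running_min (R : realType) (H : nat -> R) (k : nat) : R :=
  if k is k'.+1 then Num.min (running_min H k') (H k) else H 0%N.

Lemma running_min_le (R : realType) (H : nat -> R) (a k : nat) :
  (a <= k)%N -> running_min H k <= H a.
Proof.
elim: k => [|k IH]; first by rewrite leqn0 => /eqP->.
by rewrite leq_eqVlt ltnS ge_min => /predU1P[->|/IH->]; rewrite ?lexx ?orbT.
Qed.

Lemma running_minS (R : realType) (H : nat -> R) (k : nat) :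
  running_min H k.+1 = Num.min (running_min H k) (H k.+1).
Proof. by []. Qed.

(* Let [H] be the balance of arrivals [g * e k] at the times in [B] and service
   at unit rate throughout. The part of the slot [k] left out of [w] consists of
   the heights which [H] crosses downwards for the first and the last time in
   this slot. *)
Lemma maximal_cover (R : realType) (N : nat) (e : nat -> R) (B : pred nat) (g : R) :
  (forall k, (k < N)%N -> 0 <= e k) -> 1 <= g ->
  exists w : nat -> R,
    [/\ forall k, (k < N)%N -> 0 <= w k <= e k,
        forall a b, (a <= b <= N)%N ->
          \sum_(a <= k < b) e k <= \sum_(a <= k < b) w k \/
          g * \sum_(a <= k < b) e k *+ B k <= \sum_(a <= k < b) w k
      & \sum_(0 <= k < N) w k <= (2 * g - 1) * \sum_(0 <= k < N) e k *+ B k].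
Proof.
move=> e0 g1.
pose x k := g * (e k *+ B k) - e k.
pose H k := \sum_(0 <= i < k) x i.
have HS k : H k.+1 = H k + x k by rewrite /H big_nat_recr.
pose M := running_min H.
(* The maximum of [H] from [k] to [N]: a running minimum after negation and time reversal. *)
pose L k := - running_min (fun i => - H (N - i)%N) (N - k)%N.
have MS k : M k.+1 = Num.min (M k) (H k.+1) by [].
have LS k : (k < N)%N -> L k = Num.max (H k) (L k.+1).
  move=> kN; rewrite /L -(subnSK kN) running_minS subnSK // subKn 1?ltnW //.
  by rewrite oppr_min opprK maxC.
have M_le a k : (a <= k)%N -> M k <= H a by exact: running_min_le.
have L_ge k b : (k <= b <= N)%N -> H b <= L k.
  move=> /andP[kb bN]; rewrite /L lerNr.
  have := @running_min_le R (fun i => - H (N - i)%N) (N - b)%N (N - k)%N.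
  by rewrite subKn //; apply; lia.
have L_N : L N = H N by rewrite /L subnn /= subn0 opprK.
pose w k := e k - Num.max 0 (M k - L k.+1).
exists w; split=> [k kN|a b /andP[ab bN]|].
- have := M_le k k (leqnn k); have := L_ge k.+1 k.+1; rewrite leqnn kN => /(_ isT).
  have := e0 k kN; rewrite /w HS /x; case: (B k) => /=; rewrite ?mulr1n ?mulr0n.
    have : e k <= g * e k by rewrite ler_peMl ?e0.
    by minmax_lra.
  by minmax_lra.
(* The height ranges from [L k.+1] to [M k] left out in different slots are disjoint, and all lie
   between [L b] and [H a]. *)
- have deficit : \sum_(a <= k < b) (e k - w k) <= Num.max 0 (H a - L b).
    have : (b <= N)%N by []. 
    move: ab; move: b {bN}; elim=> [|b IH] ab bN.
      by rewrite big_geq // le_max lexx.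
    move: ab; rewrite leq_eqVlt => /predU1P[<-|ab].
      by rewrite big_geq // le_max lexx.
    rewrite big_nat_recr //=; have := IH ab (ltnW bN).
    have := M_le a b ab; have := M_le b b (leqnn b); have := L_ge b b.
    rewrite leqnn ltnW // => /(_ isT); rewrite (LS b bN) /w.
    set s := \sum_(_ <= _ < _) _.
    minmax_lra.
  have := L_ge b b; rewrite leqnn bN => /(_ isT) HL.
  have HaHb : H b - H a = g * \sum_(a <= k < b) e k *+ B k - \sum_(a <= k < b) e k.
    rewrite mulr_sumr -sumrB /H (big_cat_nat (n := a)) //= -/(H a).
    by rewrite addrAC subrr add0r.
  move: deficit; rewrite sumrB.
  by case: (leP 0 (H a - L b)); [right|left]; lra.
(* The potential [M + L - 2 H] changes by [M N - H N - L 0] in total, which is at most [0]. *)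
- have step k : (k < N)%N -> w k <= (M k.+1 - M k) + (L k.+1 - L k) - 2 * x k
                     + (2 * g - 1) * (e k *+ B k).
    move=> kN; have := M_le k k (leqnn k); have := L_ge k.+1 k.+1.
    rewrite leqnn kN => /(_ isT).
    rewrite (LS k kN) (MS k) /w HS /x; have := e0 k kN.
    case: (B k) => /=; rewrite ?mulr1n ?mulr0n ?mulr0.
      have : e k <= g * e k by rewrite ler_peMl ?e0.
      minmax_lra.
    minmax_lra.
  apply: (le_trans (ler_sum_nat (fun k kN => step k (andP kN).2))).
  rewrite big_split big_split big_split /= !telescope_sumr // sumrN.
  rewrite -!mulr_sumr -/(H N) L_N.
  have := M_le N N (leqnn N); have := L_ge 0%N 0%N isT.
  have -> : H 0%N = 0 by rewrite /H big_geq.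
  have -> : M 0%N = 0 by rewrite /M /= /H big_geq.
  by lra.
Qed.

(** * Translating between schedules and flows on a grid *)

Section Flow.
Variables (R : realType) (I : finType) (J : I -> job R).
Variables (N : nat) (t : nat -> R) (a b : I -> nat).
Hypothesis t_homo : forall k, (k < N)%N -> t k <= t k.+1.
Hypothesis ab : forall i, (a i <= b i <= N)%N.
Hypothesis ta : forall i, t (a i) = release (J i).
Hypothesis tb : forall i, t (b i) = deadline (J i).

Lemma grid_le k l : (k <= l <= N)%N -> t k <= t l.
Proof.
elim: l => [|l IH]; first by rewrite leqn0 andbT => /eqP->.
rewrite leq_eqVlt => /andP[/predU1P[->//|kl] lN].
by apply: le_trans (t_homo lN); apply: IH; rewrite -ltnS kl ltnW.
Qed.

Lemma sum_overlap_grid c d k l : (k <= l <= N)%N ->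
  \sum_(k <= i < l) overlap c d (t i) (t i.+1) = overlap c d (t k) (t l).
Proof.
elim: l => [|l IH] /andP[kl lN].
  move: kl; rewrite leqn0 => /eqP->; rewrite big_geq // /overlap !clamp_point.
  by rewrite subrr.
move: kl; rewrite leq_eqVlt => /predU1P[->|kl].
  by rewrite big_geq // /overlap !clamp_point subrr.
rewrite big_nat_recr //= IH; last by rewrite -ltnS kl ltnW.
by rewrite overlap_cat ?t_homo // grid_le // -ltnS kl ltnW.
Qed.

(** Take for [y i k] the time that job [i] is processed in interval [k]; the window of [i] contains
    all its slots, so no work is lost. *)
Lemma flow_of_schedule m (S : seq (slot R I m)) : is_schedule J S ->
  exists y : I -> nat -> R,
    [/\ forall i k, (k < N)%N -> 0 <= y i k <= t k.+1 - t k,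
        forall i, \sum_(a i <= k < b i) y i k = ptime (J i)
      & forall k, (k < N)%N -> \sum_i y i k <= m%:R * (t k.+1 - t k)].
Proof.
move=> [lenS winS compS sumS].
(* Used for the slots of one job and for those of one machine: both families are pairwise disjoint
   in time. *)
have sub (p : pred (slot R I m)) k : (k < N)%N ->
    (forall x y, p x -> p y ->
       (slot_machine x == slot_machine y) || (slot_job x == slot_job y)) ->
    \sum_(x <- S | p x) overlap (slot_start x) (slot_end x) (t k) (t k.+1)
      <= t k.+1 - t k.
  move=> kN pP; rewrite -big_filter; apply: sum_overlap_le; last exact: t_homo.
    by rewrite all_filter; apply: sub_all lenS => x /= ->; rewrite implybT.
  apply: (sub_in_pairwise (P := p)); last exact: pairwise_filter compS.
    by move=> x y px py; rewrite /compatible pP.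
  exact: filter_all.
have ov0 u v : all (fun x => 0 <= overlap (slot_start x) (slot_end x) u v) S.
  by apply: sub_all lenS => x /ltW; exact: overlap_ge0.
exists (fun i k => \sum_(x <- S | slot_job x == i)
  overlap (slot_start x) (slot_end x) (t k) (t k.+1)); split=> [i k kN|i|k kN].
- rewrite sub // => [|x y /eqP-> /eqP->]; last by rewrite eqxx orbT.
  rewrite andbT; move: (ov0 (t k) (t k.+1)); clear; elim: S => [|x S IH] /=.
    by rewrite big_nil.
  by move=> /andP[x0 /IH S0]; rewrite big_cons; case: ifP => // _; rewrite addr_ge0.
- rewrite exchange_big -sumS /=.
  clear compS sumS sub ov0; elim: S winS lenS => [|x S IH] /=; first by rewrite !big_nil.
  move=> /andP[/andP[xr xd] winS] /andP[xl lenS]; rewrite !big_cons IH //.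
  case: eqP => // xi; congr (_ + _); rewrite sum_overlap_grid // ta tb /overlap.
  rewrite -xi !clamp_id //; first by rewrite xr (le_trans (ltW xl)).
  by rewrite xd (le_trans xr) // ltW.
- rewrite -(partition_big (@slot_job R I m) xpredT (P := xpredT)) //.
  rewrite (partition_big (@slot_machine R I m) xpredT) //=.
  rewrite -[m in m%:R]card_ord -sum1_card natr_sum mulr_suml.
  apply: ler_sum => u _; rewrite mul1r; apply: sub => // x y /eqP-> /eqP->.
  by rewrite eqxx.
Qed.

(* McNaughton's wrap-around rule: in each interval of the grid, the jobs are laid
   end to end and the resulting line is cut into one piece per machine. A job
   that straddles a cut does not run on two machines at once, as its load is at
   most the length of a piece. *)
Lemma schedule_of_flow n (z : I -> 'I_N -> R) :
  (forall i k, 0 <= z i k <= (t k.+1 - t k) *+ (a i <= k < b i)%N) ->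
  (forall i, \sum_k z i k = ptime (J i)) ->
  (forall k, \sum_i z i k <= n%:R * (t k.+1 - t k)) -> feasible J n.
Proof.
move=> z_c zp zn.
have z0 i k : 0 <= z i k by case/andP: (z_c i k).
pose e (k : 'I_N) := t k.+1 - t k.
have e0 k : 0 <= e k by rewrite subr_ge0 t_homo.
have z_e i k : z i k <= e k.
  case/andP: (z_c i k) => _ /le_trans; apply.
  by case: (_ <= _ < _)%N => //; exact: e0.
(* The position at which job [i] begins on the line of interval [k], with jobs ordered by
   [enum_rank]. *)
pose P (i : I) k := \sum_(j | (enum_rank j < enum_rank i)%N) z j k.
have sum_sub (Q Q' : pred I) k : subpred Q Q' ->
    \sum_(j | Q j) z j k <= \sum_(j | Q' j) z j k.
  move=> QQ'; rewrite big_mkcond [leRHS]big_mkcond; apply: ler_sum => j _.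
  by case: ifP => [/QQ'->//|_]; case: ifP.
have P0 i k : 0 <= P i k by exact: sumr_ge0.
have P_end i k : P i k + z i k = \sum_(j | (enum_rank j <= enum_rank i)%N) z j k.
  rewrite [RHS](bigD1 i) //= addrC; congr (_ + _); apply: eq_bigl => j.
  by rewrite ltn_neqAle -(inj_eq enum_rank_inj) andbC.
have P_next i j k : (enum_rank i < enum_rank j)%N -> P i k + z i k <= P j k.
  move=> ij; rewrite P_end; apply: sum_sub => l li; exact: leq_ltn_trans li ij.
have P_total i k : P i k + z i k <= n%:R * e k.
  apply: le_trans (zn k); rewrite P_end; exact: sum_sub.
(* The part of the segment of job [i] that falls on the piece of machine [u], possibly empty; empty
   slots are filtered out below. *)
pose mk (x : 'I_N * I * 'I_n) : slot R I n :=
  let: (k, i, u) := x in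
  Slot i u (t k + clamp 0 (e k) (P i k - u%:R * e k))
           (t k + clamp 0 (e k) (P i k + z i k - u%:R * e k)).
have mk_le x : slot_start (mk x) <= slot_end (mk x).
  by case: x => [[k i] u] /=; rewrite lerD2l clamp_homo // lerD2r lerDl.
have mk_bounds (k : 'I_N) i u : t k <= slot_start (mk (k, i, u)) /\
    slot_end (mk (k, i, u)) <= t k.+1.
  rewrite /=; have /andP[h _] := clamp_bounds (P i k - u%:R * e k) (e0 k).
  have /andP[_ h'] := clamp_bounds (P i k + z i k - u%:R * e k) (e0 k).
  by split; [rewrite lerDl|rewrite addrC -lerBrDr].
have mk_interval (k k' : 'I_N) i i' u u' : (k < k')%N ->
    slot_end (mk (k, i, u)) <= slot_start (mk (k', i', u')).
  move=> kk'; apply: le_trans (mk_bounds _ _ _).1.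
  apply: le_trans (mk_bounds _ _ _).2 _; apply: grid_le.
  by rewrite kk' ltnW.
have mk_machine (k : 'I_N) i i' u : (enum_rank i < enum_rank i')%N ->
    slot_end (mk (k, i, u)) <= slot_start (mk (k, i', u)).
  by move=> ii'; rewrite lerD2l clamp_homo // lerD2r P_next.
(* The order is reversed: a straddling job runs at the start of the interval on the later machine
   and at its end on the earlier one. *)
have mk_job (k : 'I_N) i (u u' : 'I_n) : (u' < u)%N ->
    slot_end (mk (k, i, u)) <= slot_start (mk (k, i, u')).
  move=> uu'; rewrite lerD2l clamp_homo //.
  have : u'.+1%:R * e k <= u%:R * e k by rewrite ler_wpM2r ?ler_nat.
  by rewrite -natr1; have := z_e i k; lra.
exists [seq mk x | x <- enum {: 'I_N * I * 'I_n}
                    & slot_start (mk x) < slot_end (mk x)].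
split.
- by rewrite all_map all_filter; apply/allP => x _ /=; rewrite implybb.
- rewrite all_map all_filter; apply/allP => -[[k i] u] _ /=; apply/implyP => lt.
  have /andP[ak kb] : (a i <= k < b i)%N.
    have := z_c i k; case: (_ <= _ < _)%N => //= /le_anti zk.
    by move: lt; rewrite -zk addr0 ltxx.
  have [h1 h2] := mk_bounds k i u.
  rewrite -ta -tb (le_trans _ h1) ?(le_trans h2) // grid_le //.
    by rewrite kb; case/andP: (ab i).
  by rewrite ak ltnW.
- rewrite pairwise_map; apply: (@sub_pairwise _ [rel x y | x != y]); last first.
    by rewrite -uniq_pairwise filter_uniq ?enum_uniq.
  move=> [[k i] u] [[k' i'] u'] ne; rewrite /compatible; apply/implyP.
  have [kk'|k'k|/val_inj kk'] := ltngtP k k'.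
  + by move=> _; apply/orP; left; exact: mk_interval.
  + by move=> _; apply/orP; right; exact: mk_interval.
  subst k' => /orP[/eqP/= uu'|/eqP/= ii'].
    subst u'; have [ii'|i'i|/val_inj/enum_rank_inj ii'] :=
      ltngtP (enum_rank i) (enum_rank i').
    + by apply/orP; left; exact: mk_machine.
    + by apply/orP; right; exact: mk_machine.
    + by move: ne; rewrite /= ii' eqxx.
  subst i'; have [uu'|u'u|/val_inj uu'] := ltngtP u u'.
  + by apply/orP; right; exact: mk_job.
  + by apply/orP; left; exact: mk_job.
  + by move: ne; rewrite /= uu' eqxx.
- move=> i; rewrite big_map big_filter_cond big_enum_cond /= -zp.
  pose len x := slot_end (mk x) - slot_start (mk x).
  have -> : \sum_(x | (slot_start (mk x) < slot_end (mk x))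
                      && (slot_job (mk x) == i)) len x
      = \sum_(x : 'I_N * I * 'I_n) len x *+ (x.1.2 == i).
    rewrite big_mkcond; apply: eq_bigr => -[[k j] u] _; rewrite /= -/(mk (k, j, u)).
    case: (j =P i) => _; rewrite ?andbF // andbT mulr1n.
    case: ifPn => //; rewrite -leNgt => h; apply/esym/eqP.
    by rewrite subr_eq0 eq_le h mk_le.
  transitivity (\sum_k \sum_j \sum_u len (k, j, u) *+ (j == i)).
    by rewrite pair_bigA pair_bigA; apply: eq_bigr => -[[]].
  apply: eq_bigr => k _.
  under eq_bigr do rewrite sumrMnl.
  rewrite (sum_mulrb_eq (fun j => \sum_u len (k, j, u))).
  rewrite (eq_bigr (fun u : 'I_n => clamp 0 (e k) (P i k + z i k - u%:R * e k)
    - clamp 0 (e k) (P i k - u%:R * e k))) => [|u _]; last first.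
    by rewrite /len /=; ring.
  rewrite sumrB !wrap_sum ?e0 ?P_total ?P0 ?addr_ge0 //=; first by ring.
  by apply: le_trans (P_total i k); rewrite lerDl.
Qed.

(* With the fraction [w k / e k] of its work in interval [k], a job does at least
   its forced load, because [y - (e - w) <= y * (w / e)] when [y, w <= e]. *)
Lemma forced_load_le m (y : I -> nat -> R) (w : nat -> R) :
  (forall i k, (k < N)%N -> 0 <= y i k <= t k.+1 - t k) ->
  (forall i, \sum_(a i <= k < b i) y i k = ptime (J i)) ->
  (forall k, (k < N)%N -> \sum_i y i k <= m%:R * (t k.+1 - t k)) ->
  (forall k, (k < N)%N -> 0 <= w k <= t k.+1 - t k) ->
  \sum_i Num.max 0 (\sum_(a i <= k < b i) w k
                    - (deadline (J i) - release (J i) - ptime (J i)))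
    <= m%:R * \sum_(0 <= k < N) w k.
Proof.
move=> y_e yp ym w_e.
pose e k := t k.+1 - t k.
pose v i k := y i k * (w k / e k).
have f0 k : (k < N)%N -> 0 <= w k / e k.
  by move=> kN; have /andP[w0 we] := w_e k kN; rewrite divr_ge0 // (le_trans w0).
have v0 i k : (k < N)%N -> 0 <= v i k.
  by move=> kN; rewrite mulr_ge0 ?f0 //; case/andP: (y_e i k kN).
apply: (@le_trans _ _ (\sum_i \sum_(0 <= k < N) v i k)).
  apply: ler_sum => i _; have /andP[abi bN] := ab i.
  rewrite ge_max; apply/andP; split.
    by rewrite big_nat; apply: sumr_ge0 => k /andP[_ kN]; exact: v0.
  apply: (@le_trans _ _ (\sum_(a i <= k < b i) v i k)).
    rewrite -ta -tb -(telescope_sumr _ abi) -yp -!sumrB; apply: ler_sum_nat => k.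
    move=> /andP[_ kb]; have kN := leq_trans kb bN.
    have /andP[w0 we] := w_e k kN; have /andP[y0 ye] := y_e i k kN.
    (* Coinciding grid points give intervals of length zero, where the quotient takes the default
       value [0]. *)
    rewrite /v /e; have [e0|e0] := eqVneq (t k.+1 - t k) 0.
      by rewrite e0 in we ye *; rewrite invr0 mulr0 mulr0; lra.
    have egt0 : 0 < t k.+1 - t k by rewrite lt_def e0 (le_trans w0).
    rewrite mulrA ler_pdivlMr //; move: we ye egt0; set E := t k.+1 - t k => *.
    have : 0 <= (E - y i k) * (E - w k) by rewrite mulr_ge0 // subr_ge0.
    by lra.
  rewrite (big_cat_nat (n := a i) (p := N)) //=; last exact: leq_trans bN.
  rewrite (big_cat_nat (n := b i) (p := N)) //=.
  have s1 : 0 <= \sum_(0 <= k < a i) v i k.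
    rewrite big_nat; apply: sumr_ge0 => k /andP[_ ka]; apply: v0.
    by apply: leq_trans ka (leq_trans abi bN).
  have s2 : 0 <= \sum_(b i <= k < N) v i k.
    by rewrite big_nat; apply: sumr_ge0 => k /andP[_ kN]; apply: v0.
  by lra.
rewrite exchange_big mulr_sumr /=; apply: ler_sum_nat => k /andP[_ kN].
rewrite /v -mulr_suml; apply: le_trans (ler_wpM2r (f0 k kN) (ym k kN)) _.
rewrite -/(e k); have [e0|e0] := eqVneq (e k) 0.
  rewrite e0 mulr0 mul0r mulr_ge0 //; by case/andP: (w_e k kN).
by rewrite -mulrA [e k * _]mulrC divfK.
Qed.

End Flow.

(** * The grid of an instance and the bound on machines *)

Lemma grid_exists (R : realType) (I : finType) (J : I -> job R) :
  (forall i, release (J i) <= deadline (J i)) ->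
  exists (N : nat) (t : nat -> R) (a b : I -> nat),
    [/\ forall k, (k < N)%N -> t k <= t k.+1,
        forall i, (a i <= b i <= N)%N,
        forall i, t (a i) = release (J i)
      & forall i, t (b i) = deadline (J i)].
Proof.
move=> rd.
pose s := sort <=%O ([seq release (J i) | i <- enum I]
                     ++ [seq deadline (J i) | i <- enum I]).
have sorted_s : sorted <=%O s by exact: sort_le_sorted.
have rs i : release (J i) \in s by rewrite mem_sort mem_cat map_f ?mem_enum.
have ds i : deadline (J i) \in s.
  by rewrite mem_sort mem_cat [X in _ || X]map_f ?mem_enum ?orbT.
(* The [size s] points, kept with repetitions, bound one interval fewer. Equal dates get the same
   [index], so a window of length zero is harmless. *)
exists (size s).-1, (nth 0 s), (fun i => index (release (J i)) s),
  (fun i => index (deadline (J i)) s); split=> [k ks|i|i|i]; try exact: nth_index.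
  by apply: (sortedP 0 sorted_s); rewrite -ltn_predRL.
have := ds i; rewrite -index_mem => ids.
apply/andP; split; last by rewrite -ltnS prednK ?(leq_ltn_trans _ ids).
have [//|lt] := leqP.
have := sorted_leq_index le_trans lexx sorted_s _ _ (ds i) (rs i) (ltnW lt).
move=> dr; have rdE : release (J i) = deadline (J i).
  by apply/le_anti; rewrite rd dr.
by rewrite rdE ltnn in lt.
Qed.

(** In the condition on [n], the factor [2 / beta - 1] is the cost of [maximal_cover] at
    [g = beta^-1], and the factor [2] comes from tightness. *)
Lemma feasible_reduce_laxity (R : realType) (I : finType) (J : I -> job R)
    (beta : R) (m n : nat) :
  (forall i, valid_job (J i)) -> (forall i, tight (1 / 2) (J i)) ->
  0 < beta -> beta < 1 -> 2 * (2 / beta - 1) * m%:R <= n%:R :> R ->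
  feasible J m -> feasible (fun i => reduce_laxity beta (J i)) n.
Proof.
move=> valid_J tight_J beta0 beta1 mn [S schedS].
have [i|N [t [a [b [t_homo ab ta tb]]]]] := @grid_exists R I J.
  by have /andP[p0 pd] := valid_J i; rewrite -subr_ge0 (le_trans p0).
have [y [y_e yp ym]] := flow_of_schedule t_homo ab ta tb schedS.
pose e k := t k.+1 - t k.
have e0 k : (k < N)%N -> 0 <= e k by move=> kN; rewrite subr_ge0 t_homo.
pose win i k := (a i <= k < b i)%N.
have to_nat i (F : nat -> R) :
    \sum_(k < N) F k *+ win i k = \sum_(a i <= k < b i) F k.
  have /andP[abi bN] := ab i.
  rewrite [RHS]big_geq_mkord (big_ord_widen_cond _ _ _ bN) [RHS]big_mkcond.
  by apply: eq_bigr => k _; rewrite /win; case: (a i <= k)%N; case: (k < b i)%N.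
have len_e i : \sum_(a i <= k < b i) e k = deadline (J i) - release (J i).
  by have /andP[abi _] := ab i; rewrite telescope_sumr // ta tb.
have [i|i k|A B|z [z_c zp zn]] := @gale R I 'I_N
    (fun i => ptime (reduce_laxity beta (J i))) (fun k => n%:R * e k)
    (fun i k => e k *+ win i k).
- have /andP[p0 pd] := valid_J i; rewrite addr_ge0 // mulr_ge0 //; lra.
- by rewrite mulrn_wge0 // e0.
(* [B] as a predicate on [nat], false from [N] on. *)
- pose Bn k := oapp (fun k' : 'I_N => k' \in B) false (insub k).
  have BnE (k : 'I_N) : Bn k = (k \in B) by rewrite /Bn valK.
  have inv1 : 1 <= beta^-1 by rewrite invf_ge1 // ltW.
  have [w [w_e w_cover w_total]] := maximal_cover Bn e0 inv1.
  pose F i := Num.max 0 (\sum_(a i <= k < b i) w k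
                    - (deadline (J i) - release (J i) - ptime (J i))).
  have F0 i : 0 <= F i by rewrite le_max lexx.
  have sumF : \sum_i F i <= m%:R * \sum_(0 <= k < N) w k.
    exact: (forced_load_le ab ta tb y_e yp ym w_e).
  (* With [x] the length of [B] in the window, the left side equals [x] minus the reduced laxity. *)
  have job_le i : ptime (reduce_laxity beta (J i))
      - \sum_(a i <= k < b i) e k *+ ~~ Bn k <= 2 * F i.
    have -> : \sum_(a i <= k < b i) e k *+ ~~ Bn k =
        \sum_(a i <= k < b i) e k - \sum_(a i <= k < b i) e k *+ Bn k.
      rewrite -sumrB; apply: eq_bigr => k _.
      by case: (Bn k); rewrite /= ?subrr ?subr0.
    set x := \sum_(a i <= k < b i) e k *+ Bn k.
    have x_le : x <= \sum_(a i <= k < b i) e k.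
      rewrite /x; apply: ler_sum_nat => k /andP[_ kb]; have /andP[_ bN] := ab i.
      by case: (Bn k) => //=; apply: e0; exact: leq_trans bN.
    have := F0 i; have := tight_J i; have /andP[p0 pd] := valid_J i.
    rewrite /tight len_e /= => tJ Fi0; rewrite len_e in x_le.
    have F_ge : \sum_(a i <= k < b i) w k
       - (deadline (J i) - release (J i) - ptime (J i)) <= F i.
      by rewrite le_max lexx orbT.
    have [|wx|wx] := w_cover (a i) (b i); first exact: ab.
      (* The window is covered, so [F i] is at least the old processing time, which by tightness
         exceeds half the window. *)
      rewrite len_e in wx.
      have : 0 <= beta * (deadline (J i) - release (J i) - ptime (J i)).
        by rewrite mulr_ge0 ?(ltW beta0) // subr_ge0.
      by lra.
    (* Here the cover has length at least [x / beta] in the window; scaling [F_ge] by [beta] gives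
       the reduced laxity. *)
    have : x - beta * (deadline (J i) - release (J i) - ptime (J i)) <= beta * F i.
      rewrite -(ler_pM2l beta0) in F_ge; apply: le_trans F_ge.
      rewrite [leRHS]mulrBr lerD2r; move: wx; rewrite -/x -(ler_pM2l beta0).
      by rewrite mulrA mulfV ?mul1r // gt_eqF.
    have : beta * F i <= 2 * F i by rewrite ler_wpM2r //; lra.
    by lra.
  rewrite /cut_slack.
  have -> : \sum_(k < N) n%:R * e k *+ (k \in B) =
      n%:R * \sum_(0 <= k < N) e k *+ Bn k.
    rewrite big_mkord mulr_sumr; apply: eq_bigr => k _.
    by rewrite BnE mulrnAr.
  (* Since [F i] is nonnegative, jobs outside [A] can be included, which makes the bound uniform in
     [A]. *)
  have loads : \sum_i ptime (reduce_laxity beta (J i)) *+ (i \in A)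
      - \sum_i \sum_(k < N) e k *+ win i k *+ ((i \in A) && (k \notin B))
      <= 2 * \sum_i F i.
    rewrite -sumrB mulr_sumr; apply: ler_sum => i _.
    case: (i \in A) => /=; last by rewrite big1 // subr0 mulr_ge0.
    apply: le_trans (job_le i); rewrite -to_nat lerD2l lerN2; apply: ler_sum => k _.
    by rewrite BnE mulrnAC.
  set V := \sum_(0 <= k < N) _ in w_total *.
  have V0 : 0 <= V.
    rewrite /V big_nat; apply: sumr_ge0 => k /andP[_ kN].
    by rewrite mulrn_wge0 ?e0.
  have := ler_wpM2r V0 mn; have := ler_wpM2l (ler0n R m) w_total.
  move: sumF loads; set sw := \sum_(0 <= k < N) w k; set sF := \sum_i F i.
  by lra.
exact: (schedule_of_flow (J := fun i => reduce_laxity beta (J i))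
  t_homo ab ta tb z_c zp zn).
Qed.

Theorem theorem19 (R : realType) (I : finType) (J : I -> job R) (beta : R)
  (valid_J : forall i : I, valid_job (J i))
  (tight_J : forall i : I, tight (1 / 2) (J i))
  (beta_gt0 : 0 < beta) (beta_lt1 : beta < 1) :
  (min_machines (fun i : I => reduce_laxity beta (J i)))%:R
    <= 4 / beta * (min_machines J)%:R :> R.
Proof.
have [feasJ _] := min_machinesP valid_J.
set m := min_machines J in feasJ *.
have q0 : 0 <= 4 / beta * m%:R by rewrite mulr_ge0 // divr_ge0 // ltW.
have valid_Jb i : valid_job (reduce_laxity beta (J i)).
  have /andP[p0 pd] := valid_J i; rewrite /valid_job /=.
  have : 0 <= beta * (deadline (J i) - release (J i) - ptime (J i)).
    by rewrite mulr_ge0 ?(ltW beta_gt0) // subr_ge0.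
  have : 0 <= (1 - beta) * (deadline (J i) - release (J i) - ptime (J i)).
    by rewrite mulr_ge0 ?subr_ge0 ?(ltW beta_lt1).
  by move=> h1 h2; apply/andP; split; lra.
have [_ minJb] := min_machinesP valid_Jb.
(* The schedule uses the integer part of [4 m / beta] machines. *)
apply: (@le_trans _ _ (Num.truncn (4 / beta * m%:R))%:R); last by rewrite truncn_le.
 rewrite ler_nat.
apply: minJb; apply: (feasible_reduce_laxity (m := m)) => //.
have := truncnS_gt (4 / beta * m%:R); rewrite -natr1.
(* Truncation loses less than [1], which the spare [2 m] covers once [m] is positive; for [m = 0]
   the required bound is [0]. *)
have [->|m1] := posnP m; first by rewrite !mulr0 ler0n.
have : 1 <= m%:R :> R by rewrite ler1n.
by move: (Num.truncn _) => N; nra.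
Qed.
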